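(* Consider the constrained pricing problem under the finite mixture of logit (FMNL) model with $m$ products, $T$ customer segments and $K$ linear price constraints: $$\max_{\mathbf{p}\in\mathcal{P}}\ R(\mathbf{p})=\sum_{t=1}^T d_t\,\frac{\sum_{i\in[m]}p_i\exp(a_{ti}-b_ip_i)}{1+\sum_{j\in[m]}\exp(a_{tj}-b_jp_j)},\qquad \mathcal{P}=\Bigl\{\mathbf{p}\in\mathbb{R}^m: L_i\le p_i\le U_i\ \forall i\in[m],\ \sum_{i=1}^m\alpha_{ki}p_i\le\beta_k\ \forall k\in[K]\Bigr\},$$ where $d_t>0$, $\sum_{t}d_t=1$, $b_i>0$, $\alpha_{ki}\ge0$, and $\mathcal{P}\ne\emptyset$. For any optimality tolerance $\varepsilon\in(0,1)$, the spatial branch-and-bound algorithm described in the context terminates with an $\varepsilon$-optimal solution. For a fixed number of customer segments $T$, the total time complexity is bounded by $$\underbrace{O\!\left(\left(\tfrac1\varepsilon\right)^T\right)}_{\text{number of nodes}}\times\underbrace{O\!\left(n^3\sqrt m\,\log\left(\tfrac1\varepsilon\right)\right)}_{\text{exponential cone solver cost}},$$ where $n=\Theta(m+K)$ denotes the problem dimension at each node. In particular, if $K=O(m)$ and $T$ is bounded, the overall complexity simplifies to $O\bigl((\tfrac1\varepsilon)^T m^{3.5}\log(\tfrac1\varepsilon)\bigr)$. Consequently, when the number of customer segments $T$ is bounded, the algorithm runs in time polynomial in the problem size and the inverse accuracy $1/\varepsilon$.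
   Context: $[m]=\{1,\dots,m\}$. A feasible $\mathbf{p}\in\mathcal{P}$ is $\varepsilon$-optimal if $R(\mathbf{p})\ge\max_{\mathcal{P}}R-\varepsilon$. The price sensitivities $b_i$ do not depend on the segment. Bilinear reformulation. With $u_i=e^{-b_ip_i}$ the problem is rewritten as $$\begin{aligned}\max_{\mathbf{u},\mathbf{y},\mathbf{z},\mathbf{s},\mathbf{v},\boldsymbol\theta}\ & \sum_{t=1}^Td_t\theta_t\\ \text{s.t. } & y_t=\theta_tz_t,\quad y_t\le\sum_{i=1}^m\Bigl(-\tfrac{e^{a_{ti}}}{b_i}\Bigr)s_i,\quad z_t\ge1+\sum_{j=1}^me^{a_{tj}}u_j,\quad t\in[T],\\ & \sum_{i=1}^m\tfrac{\alpha_{ki}}{b_i}(-v_i)\le\beta_k,\quad k\in[K],\\ & -b_iU_i\le v_i\le-b_iL_i,\quad(-s_i,u_i,1)\in\mathcal{K}_{\exp},\quad(v_i,1,u_i)\in\mathcal{K}_{\exp},\quad i\in[m],\end{aligned}$$ where $\mathcal{K}_{\exp}=\{(x,y,z): y>0,\ ye^{x/y}\le z\}\cup\{(x,0,z): x\le0,\ z\ge0\}$. Node relaxation. Each node of the search tree carries bounds $[\underline\theta_t,\overline\theta_t]$ and $[\underline z_t,\overline z_t]$ for all $t$. Its relaxation $\mathcal{M}$ is the convex exponential cone program obtained by adding these bounds and the global bounds on $u_i$ and replacing each equality $y_t=\theta_tz_t$ by the McCormick inequalities $$y_t\ge\underline\theta_tz_t+\underline z_t\theta_t-\underline\theta_t\underline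 z_t,\quad y_t\ge\overline\theta_tz_t+\overline z_t\theta_t-\overline\theta_t\overline z_t,\quad y_t\le\overline\theta_tz_t+\underline z_t\theta_t-\overline\theta_t\underline z_t,\quad y_t\le\underline\theta_tz_t+\overline z_t\theta_t-\underline\theta_t\overline z_t.$$ Initial (root) bounds. $\underline u_i=e^{-b_iU_i}$, $\overline u_i=e^{-b_iL_i}$; $\underline z_t=1+\sum_ie^{a_{ti}}\underline u_i$, $\overline z_t=1+\sum_ie^{a_{ti}}\overline u_i$; $\underline s_i$ and $\overline s_i$ are the minimum and maximum of $u\ln u$ over $[\underline u_i,\overline u_i]$; $\underline y_t=\sum_i(-e^{a_{ti}}/b_i)\overline s_i$, $\overline y_t=\sum_i(-e^{a_{ti}}/b_i)\underline s_i$; and $[\underline\theta_t,\overline\theta_t]$ is obtained by interval division of $[\underline y_t,\overline y_t]$ by $[\underline z_t,\overline z_t]$, i.e. $\underline\theta_t=\min\{\underline y_t/\underline z_t,\underline y_t/\overline z_t\}$, $\overline\theta_t=\max\{\overline y_t/\underline z_t,\overline y_t/\overline z_t\}$. Algorithm. Keep a priority queue $\mathcal{Q}$ of nodes ordered by upper bound (best-first), initially $\mathcal{Q}=\{\text{root}\}$, with incumbent value $R^*=-\infty$ and no incumbent price vector. While $\mathcal{Q}\neq\emptyset$: (1) pop the best node $N$ and solve its relaxation, giving an upper bound $U_N$ and a solution $(\hat{\mathbf{u}},\hat{\mathbf{y}},\hat{\mathbf{z}},\hat{\boldsymbol\theta})$; (2) if the relaxation is infeasible or $U_N\le R^*$,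 discard $N$ and continue; (3) set $\hat p_i=-\ln(\hat u_i)/b_i$ and, if $R(\hat{\mathbf{p}})>R^*$, update the incumbent $R^*\leftarrow R(\hat{\mathbf{p}})$, $\mathbf{p}^*\leftarrow\hat{\mathbf{p}}$; (4) compute $\delta_t=|\hat y_t-\hat\theta_t\hat z_t|$ and $\delta_{\max}=\max_t\delta_t$; if $\delta_{\max}\le\varepsilon$, stop; (5) otherwise let $t^*\in\arg\max_t\delta_t$, choose whichever of $\theta_{t^*},z_{t^*}$ has the larger current interval, bisect that interval, and add the two resulting child nodes to $\mathcal{Q}$. Output $\mathbf{p}^*,R^*$. Each node relaxation is solved numerically to accuracy $\Theta(\varepsilon)$. Cost model for the node solver: a primal--dual interior-point method on a conic program with self-concordant barrier parameter $\nu$ (here $\nu=\Theta(m)$) reaches accuracy $\delta$ in $O(\sqrt\nu\log(1/\delta))$ Newton iterations, each costing $O(n^3)$ arithmetic operations.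
   Formalization: ε-optimality assumes Σ_i p_i exp(a_ti − b_i p_i) ≥ 0 for all feasible p and all t (automatic if L_i ≥ 0; false otherwise) and a small enough Θ(ε) constant; the O constants depend on the size of the root boxes or on a data bound, and time bounds are for small ε. *)

(* Defs.v *)
From Stdlib Require List.
From mathcomp Require Import all_boot all_order all_algebra.
From mathcomp Require Import all_classical all_reals all_analysis.

Set Implicit Arguments.
Unset Strict Implicit.
Unset Printing Implicit Defensive.
Import Order.TTheory GRing.Theory Num.Theory.
Local Open Scope classical_set_scope.
Local Open Scope ring_scope.

(* T segments, m products, K linear price constraints. *)
Record fmnl (R : realType) (T m K : nat) := FMNL {
  util : 'I_T -> 'I_m -> R;    (* a_ti *)
  sens : 'I_m -> R;            (* b_i *)
  weight : 'I_T -> R;          (* d_t *)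
  pmin : 'I_m -> R;            (* L_i *)
  pmax : 'I_m -> R;            (* U_i *)
  coef : 'I_K -> 'I_m -> R;    (* alpha_ki *)
  rhs : 'I_K -> R              (* beta_k *)
}.

Definition sales_num (R : realType) T m K (I : fmnl R T m K) (p : 'I_m -> R) t :=
  \sum_i p i * expR (util I t i - sens I i * p i).

Definition sales_den (R : realType) T m K (I : fmnl R T m K) (p : 'I_m -> R) t :=
  1 + \sum_j expR (util I t j - sens I j * p j).

Definition revenue (R : realType) T m K (I : fmnl R T m K) (p : 'I_m -> R) : R :=
  \sum_t weight I t * (sales_num I p t / sales_den I p t).

Definition feasible_price (R : realType) T m K (I : fmnl R T m K)
    (p : 'I_m -> R) : Prop :=
  (forall i, pmin I i <= p i <= pmax I i) /\
  (forall k, \sum_i coef I k i * p i <= rhs I k).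

Definition wf_instance (R : realType) T m K (I : fmnl R T m K) : Prop :=
  [/\ forall t, 0 < weight I t, \sum_t weight I t = 1,
      forall i, 0 < sens I i, forall k i, 0 <= coef I k i
    & exists p, feasible_price I p].

(* Automatic when 0 <= pmin I i for all i.  The relaxed constraint z_t >= D_t
   of the bilinear problem is tight at an optimum only if the numerators are
   nonnegative; with negative ones, increasing z_t increases y_t / z_t. *)
Definition nonneg_sales (R : realType) T m K (I : fmnl R T m K) : Prop :=
  forall p t, feasible_price I p -> 0 <= sales_num I p t.

Definition eps_optimal (R : realType) T m K (I : fmnl R T m K) (eps : R)
    (p : 'I_m -> R) : Prop :=
  feasible_price I p /\
  (forall q, feasible_price I q -> revenue I q - eps <= revenue I p).

Definition bounded_data (R : realType) T m K (B : R) (I : fmnl R T m K) : Prop :=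
  (forall t i, `|util I t i| <= B) /\
  (forall i, [/\ `|sens I i| <= B, `|pmin I i| <= B & `|pmax I i| <= B]).

Definition Kexp (R : realType) (x y z : R) : Prop :=
  (0 < y /\ y * expR (x / y) <= z) \/ [/\ y = 0, x <= 0 & 0 <= z].

Record cone_point (R : realType) (T m : nat) := ConePoint {
  pt_u : 'I_m -> R;
  pt_s : 'I_m -> R;
  pt_v : 'I_m -> R;
  pt_y : 'I_T -> R;
  pt_z : 'I_T -> R;
  pt_theta : 'I_T -> R
}.

Record node (R : realType) (T : nat) := Node {
  theta_lo : 'I_T -> R;
  theta_hi : 'I_T -> R;
  z_lo : 'I_T -> R;
  z_hi : 'I_T -> R
}.

Definition root_u_lo (R : realType) T m K (I : fmnl R T m K) i :=
  expR (- (sens I i * pmax I i)).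
Definition root_u_hi (R : realType) T m K (I : fmnl R T m K) i :=
  expR (- (sens I i * pmin I i)).
Definition root_z_lo (R : realType) T m K (I : fmnl R T m K) t :=
  1 + \sum_i expR (util I t i) * root_u_lo I i.
Definition root_z_hi (R : realType) T m K (I : fmnl R T m K) t :=
  1 + \sum_i expR (util I t i) * root_u_hi I i.
Definition root_s_lo (R : realType) T m K (I : fmnl R T m K) i : R :=
  inf [set u * ln u | u in `[root_u_lo I i, root_u_hi I i]].
Definition root_s_hi (R : realType) T m K (I : fmnl R T m K) i : R :=
  sup [set u * ln u | u in `[root_u_lo I i, root_u_hi I i]].
Definition root_y_lo (R : realType) T m K (I : fmnl R T m K) t :=
  \sum_i (- (expR (util I t i) / sens I i)) * root_s_hi I i.
Definition root_y_hi (R : realType) T m K (I : fmnl R T m K) t :=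
  \sum_i (- (expR (util I t i) / sens I i)) * root_s_lo I i.

Definition root_node (R : realType) T m K (I : fmnl R T m K) : node R T := {|
  theta_lo := fun t => Num.min (root_y_lo I t / root_z_lo I t)
                               (root_y_lo I t / root_z_hi I t);
  theta_hi := fun t => Num.max (root_y_hi I t / root_z_lo I t)
                               (root_y_hi I t / root_z_hi I t);
  z_lo := root_z_lo I;
  z_hi := root_z_hi I
|}.

Definition theta_width (R : realType) T (N : node R T) t := theta_hi N t - theta_lo N t.
Definition z_width (R : realType) T (N : node R T) t := z_hi N t - z_lo N t.

Definition conic_feasible (R : realType) T m K (I : fmnl R T m K)
    (x : cone_point R T m) : Prop :=
  [/\ forall t, pt_y x t <= \sum_i (- (expR (util I t i) / sens I i)) * pt_s x i,
      forall t, 1 + \sum_j expR (util I t j) * pt_u x j <= pt_z x t,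
      forall k, \sum_i coef I k i / sens I i * (- pt_v x i) <= rhs I k
    & forall i, [/\ - (sens I i * pmax I i) <= pt_v x i <= - (sens I i * pmin I i),
                    Kexp (- pt_s x i) (pt_u x i) 1
                  & Kexp (pt_v x i) 1 (pt_u x i)]].

Definition mccormick (R : realType) (thl thh zl zh th z y : R) : Prop :=
  [/\ thl * z + zl * th - thl * zl <= y,
      thh * z + zh * th - thh * zh <= y,
      y <= thh * z + zl * th - thh * zl
    & y <= thl * z + zh * th - thl * zh].

Definition relax_feasible (R : realType) T m K (I : fmnl R T m K) (N : node R T)
    (x : cone_point R T m) : Prop :=
  [/\ conic_feasible I x,
      forall i, root_u_lo I i <= pt_u x i <= root_u_hi I i,
      forall t, theta_lo N t <= pt_theta x t <= theta_hi N t,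
      forall t, z_lo N t <= pt_z x t <= z_hi N t
    & forall t, mccormick (theta_lo N t) (theta_hi N t) (z_lo N t) (z_hi N t)
                          (pt_theta x t) (pt_z x t) (pt_y x t)].

Definition objective (R : realType) T m K (I : fmnl R T m K) (x : cone_point R T m) : R :=
  \sum_t weight I t * pt_theta x t.

(* solve N = None reports infeasibility; solve N = Some (UN, x) returns a
   certified upper bound UN on the relaxation and a feasible point x whose
   objective value is within tau of UN. *)
Definition node_solver (R : realType) T m K (I : fmnl R T m K) (tau : R)
    (solve : node R T -> option (R * cone_point R T m)) : Prop :=
  forall N, match solve N with
  | None => forall x, ~ relax_feasible I N x
  | Some (UN, x) =>
      [/\ relax_feasible I N x, UN - tau <= objective I x
        & forall x', relax_feasible I N x' -> objective I x' <= UN]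
  end.

Definition node_bound (R : realType) T m
    (solve : node R T -> option (R * cone_point R T m)) (N : node R T) : \bar R :=
  if solve N is Some (UN, _) then UN%:E else -oo%E.

Definition price_of (R : realType) T m K (I : fmnl R T m K) (x : cone_point R T m)
  : 'I_m -> R := fun i => - ln (pt_u x i) / sens I i.

Definition gap (R : realType) T m (x : cone_point R T m) t : R :=
  `|pt_y x t - pt_theta x t * pt_z x t|.

Definition set_at (R : realType) T (f : 'I_T -> R) (t : 'I_T) (v : R) : 'I_T -> R :=
  fun t' => if t' == t then v else f t'.

Variant bisect (R : realType) T (N : node R T) (t : 'I_T)
  : node R T -> node R T -> Prop :=
| BisectTheta of z_width N t <= theta_width N t :
    let c := (theta_lo N t + theta_hi N t) / 2 in
    bisect N t
      (Node (theta_lo N) (set_at (theta_hi N) t c) (z_lo N) (z_hi N))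
      (Node (set_at (theta_lo N) t c) (theta_hi N) (z_lo N) (z_hi N))
| BisectZ of theta_width N t <= z_width N t :
    let c := (z_lo N t + z_hi N t) / 2 in
    bisect N t
      (Node (theta_lo N) (theta_hi N) (z_lo N) (set_at (z_hi N) t c))
      (Node (theta_lo N) (theta_hi N) (set_at (z_lo N) t c) (z_hi N)).

(* [created] lists every node ever put in the queue, the root included; the
   relaxation of each of them is solved once. *)
Record state (R : realType) (T m : nat) := State {
  queue : seq (node R T);
  incumbent : option ('I_m -> R);
  created : seq (node R T);
  stopped : bool
}.

Definition init_state (R : realType) T m K (I : fmnl R T m K) : state R T m :=
  State [:: root_node I] None [:: root_node I] false.

Definition halted (R : realType) T m (s : state R T m) : bool :=
  stopped s || nilp (queue s).

Definition incumbent_value (R : realType) T m K (I : fmnl R T m K)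
    (best : option ('I_m -> R)) : \bar R :=
  if best is Some p then (revenue I p)%:E else -oo%E.

Definition update_incumbent (R : realType) T m K (I : fmnl R T m K)
    (best : option ('I_m -> R)) (p : 'I_m -> R) : option ('I_m -> R) :=
  if (incumbent_value I best < (revenue I p)%:E)%E then Some p else best.

(* The popped node maximizes its own relaxation bound among the queued nodes.
   Ties (in the pop, in the arg max over t, and between the two intervals) may
   be broken in any way. *)
Definition pops (R : realType) T m (solve : node R T -> option (R * cone_point R T m))
    (Q : seq (node R T)) (N : node R T) (Q' : seq (node R T)) : Prop :=
  (exists Q1 Q2, Q = Q1 ++ N :: Q2 /\ Q' = Q1 ++ Q2) /\
  (forall M, List.In M Q -> (node_bound solve M <= node_bound solve N)%E).

Variant step (R : realType) T m K (I : fmnl R T m K) (eps : R)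
    (solve : node R T -> option (R * cone_point R T m))
  : state R T m -> state R T m -> Prop :=
| StepDiscard Q best cr N Q' of
      pops solve Q N Q'
    & (node_bound solve N <= incumbent_value I best)%E :
    step I eps solve (State Q best cr false) (State Q' best cr false)
| StepStop Q best cr N Q' UN x of
      pops solve Q N Q'
    & solve N = Some (UN, x)
    & (incumbent_value I best < UN%:E)%E
    & (forall t, gap x t <= eps) :
    step I eps solve (State Q best cr false)
      (State Q' (update_incumbent I best (price_of I x)) cr true)
| StepBranch Q best cr N Q' UN x t N1 N2 of
      pops solve Q N Q'
    & solve N = Some (UN, x)
    & (incumbent_value I best < UN%:E)%E
    & eps < gap x t
    & (forall t', gap x t' <= gap x t)
    & bisect N t N1 N2 :
    step I eps solve (State Q best cr false)
      (State [:: N1, N2 & Q'] (update_incumbent I best (price_of I x))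
             [:: N1, N2 & cr] false).

(* Total correctness: every run from s is finite, never gets stuck, and halts
   in a state satisfying P. *)
Inductive terminates_with (R : realType) T m K (I : fmnl R T m K) (eps : R)
    (solve : node R T -> option (R * cone_point R T m)) (P : state R T m -> Prop)
  : state R T m -> Prop :=
| TerminatesHalt s of halted s & P s : terminates_with I eps solve P s
| TerminatesStep s of ~~ halted s
    & (exists s', step I eps solve s s')
    & (forall s', step I eps solve s s' -> terminates_with I eps solve P s') :
    terminates_with I eps solve P s.

Definition bb_terminates (R : realType) T m K (I : fmnl R T m K) (eps : R)
    (solve : node R T -> option (R * cone_point R T m)) (P : state R T m -> Prop) : Prop :=
  terminates_with I eps solve P (init_state I).

Definition outputs_eps_optimal (R : realType) T m K (I : fmnl R T m K) (eps : R)
    (s : state R T m) : Prop :=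
  if incumbent s is Some p then eps_optimal I eps p else False.

Definition Theta_of (R : realType) (kappa x y : R) : Prop :=
  y / kappa <= x <= kappa * y.

Definition node_cost (R : realType) T (newton ops : node R T -> nat) N : nat :=
  (newton N * ops N)%N.

Definition total_time (R : realType) T m (newton ops : node R T -> nat)
    (s : state R T m) : nat :=
  (\sum_(N <- created s) node_cost newton ops N)%N.

(* [newton N] Newton iterations of at most [ops N] arithmetic operations each;
   all constants of the O's and Theta's are absorbed in kappa > 1, and the
   iteration bound is asymptotic in the accuracy (1 / kappa is the threshold). *)
Definition cost_model (R : realType) (kappa : R) (T m K n nu : nat) (eps tau : R)
    (newton ops : node R T -> nat) : Prop :=
  [/\ Theta_of kappa nu%:R m%:R, Theta_of kappa n%:R (m + K)%:R,
      Theta_of kappa tau eps,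
      tau <= 1 / kappa -> forall N,
        (newton N)%:R <= kappa * (Num.sqrt nu%:R * ln (1 / tau))
    & forall N, (ops N)%:R <= kappa * n%:R ^+ 3].

Definition root_area_le (R : realType) T m K (W : R) (I : fmnl R T m K) : Prop :=
  forall t, theta_width (root_node I) t * z_width (root_node I) t <= W.

(* Main.v *)
Require Import Defs.
From mathcomp Require Import all_boot all_order all_algebra.
From mathcomp Require Import all_classical all_reals all_analysis.
From mathcomp Require Import ring lra zify.
From Stdlib Require List.
Import Order.TTheory GRing.Theory Num.Theory.
Local Open Scope ring_scope.

Set Implicit Arguments.
Unset Strict Implicit.
Unset Printing Implicit Defensive.

(** Optimality. A feasible price vector [q] lifts to the point [lift_price I q]
    of the bilinear program, with [y_t = theta_t * z_t], so this point satisfies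
    the McCormick inequalities of every box that contains its [theta] and [z]
    coordinates.  Bisection never loses it: at every moment either
    some queued box contains the lift of [q], and then the bound of that node is
    at least [revenue I q], or the incumbent is already at least as good as [q].
    This is the invariant [sound].  In the other direction, the prices [p] read
    off a solution of a relaxation are feasible, because [u_i >= exp v_i] and the
    coefficients of the linear constraints are nonnegative; their sales
    numerators are at least [y_t] and their denominators at most [z_t].  If all
    gaps are at most [eps], then [theta_t <= (y_t + eps) / z_t], and since the
    numerators at [p] are nonnegative, [theta_t] exceeds the true ratio at [p] by
    at most [eps] divided by the denominator.  The denominators are at least
    [1 + h], where [h > 0] depends only on the bound on the data, so [p] loses at
    most [eps / (1 + h)] with respect to the objective value; what remains of
    [eps] pays for the inexact solver ([stop_revenue]).

    Node count. The McCormick inequalities force [|y - theta z|] to be at most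
    the area of the box of [(theta_t, z_t)].  So a segment [t] is branched on only
    while its area exceeds [eps], and each bisection halves that area.  Give a
    node the weight [\prod_t max 1 (2 area_t / eps)]: both children of a branched
    node have exactly half the weight of their parent, hence branching conserves
    the total weight of the leaves of the search tree.  Each leaf weighs at least
    [1], so there are at most as many leaves as the weight of the root, which is
    [O((1 / eps) ^+ T)].  The [potential] expresses this for a state of the run;
    it also yields termination ([bb_terminates_invariant]).

    Time. The cost of one node is a direct computation from the cost model once
    [eps <= 1 / kappa ^+ 2], which makes [ln (1 / tau) <= 2 * ln (1 / eps)].  For
    polynomiality in the size of the instance, the root areas of an instance
    with bounded data are [O(m ^+ 2)] ([root_area_quadratic]). *)

(** * Halving McCormick boxes *)

(** The first under- and overestimators differ from [th * z] by
    [(th - thl) * (z - zl)] and [(thh - th) * (z - zl)]. *)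
Lemma mccormick_gap (R : realType) (thl thh zl zh th z y : R) :
  mccormick thl thh zl zh th z y -> thl <= th <= thh -> zl <= z <= zh ->
  `|y - th * z| <= (thh - thl) * (zh - zl).
Proof.
case=> lo _ hi _ /andP[th1 th2] /andP[z1 z2].
have under_hi : (thh - th) * (z - zl) <= (thh - thl) * (zh - zl).
  by apply: ler_pM; lra.
have under_lo : (th - thl) * (z - zl) <= (thh - thl) * (zh - zl).
  by apply: ler_pM; lra.
rewrite ler_norml; apply/andP; split; nra.
Qed.

Definition area (R : realType) T (N : node R T) t := theta_width N t * z_width N t.

(** The factor [2] makes the entry at least [2] whenever segment [t] may be
    branched on, so that the truncation at [1] does not interfere with halving. *)
Definition weight_at (R : realType) T (eps : R) (N : node R T) t : R :=
  Num.max 1 (2 * area N t / eps).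

Definition node_weight (R : realType) T (eps : R) (N : node R T) : R :=
  \prod_t weight_at eps N t.

Lemma node_weight_ge1 (R : realType) T (eps : R) (N : node R T) :
  1 <= node_weight eps N.
Proof.
rewrite /node_weight; elim/big_rec: _ => // t x _ x1.
by apply: mulr_ege1 => //; rewrite le_max lexx.
Qed.

Lemma area_bisect (R : realType) T (N N1 N2 : node R T) t :
  bisect N t N1 N2 ->
  forall t', area N1 t' = (if t' == t then area N t / 2 else area N t')
          /\ area N2 t' = (if t' == t then area N t / 2 else area N t').
Proof.
by case=> _ c t'; rewrite /area /theta_width /z_width /= /set_at;
  case: eqP => [->|//]; split; rewrite /c; field.
Qed.

Lemma node_weight_bisect (R : realType) T (eps : R) (N N1 N2 : node R T) t :
  0 < eps -> eps < area N t -> bisect N t N1 N2 ->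
  node_weight eps N1 = node_weight eps N / 2 /\
  node_weight eps N2 = node_weight eps N / 2.
Proof.
move=> eps0 big /area_bisect areas.
have halve M : (forall t', area M t' = if t' == t then area N t / 2 else area N t') ->
    node_weight eps M = node_weight eps N / 2.
  move=> areaM; rewrite /node_weight (bigD1 t) //= [in RHS](bigD1 t) //=.
  rewrite mulrAC; congr (_ * _); last first.
    by apply: eq_bigr => t' /negbTE t'Nt; rewrite /weight_at areaM t'Nt.
  have q1 : 1 < area N t / eps by rewrite ltr_pdivlMr // mul1r.
  rewrite /weight_at areaM eqxx !max_r; first by field; lra.
    by rewrite -mulrA; lra.
  by rewrite mulrCA divff // mulr1 ltW.
by split; apply: halve => t'; case: (areas t').
Qed.

Lemma gap_le_area (R : realType) T m K (I : fmnl R T m K) N x t :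
  relax_feasible I N x -> gap x t <= area N t.
Proof. by case=> _ _ thb zb mc; apply: mccormick_gap (mc t) (thb t) (zb t). Qed.

(** * Termination and the number of created nodes *)

(** A subtree whose root weighs [w] has at most [w] leaves, so it adds at most
    [2 * w - 2] nodes to its root: the potential is the number of nodes created
    so far plus what the queued nodes can still contribute. *)
Definition potential (R : realType) T m (eps : R) (s : state R T m) : R :=
  (size (created s))%:R + \sum_(N <- queue s) (2 * node_weight eps N - 2).

Lemma created_le_potential (R : realType) T m (eps : R) (s : state R T m) :
  (size (created s))%:R <= potential eps s.
Proof.
rewrite /potential lerDl; apply: sumr_ge0 => N _.
by have := node_weight_ge1 eps N; lra.
Qed.

Lemma pops_sum (R : realType) T m (solve : node R T -> option (R * cone_point R T m))
    Q N Q' (F : node R T -> R) :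
  pops solve Q N Q' -> \sum_(M <- Q) F M = F N + \sum_(M <- Q') F M.
Proof. by case=> -[Q1 [Q2 [-> ->]]] _; rewrite !big_cat big_cons /= addrCA. Qed.

Lemma pops_size (R : realType) T m (solve : node R T -> option (R * cone_point R T m))
    Q N Q' : pops solve Q N Q' -> size Q = (size Q').+1.
Proof. by case=> -[Q1 [Q2 [-> ->]]] _; rewrite !size_cat addnS. Qed.

(** Branching replaces [2 * w - 2] by twice [w - 2], which pays for exactly
    the two new nodes; popping a node without branching forgets a nonnegative
    term. *)
Lemma potential_step (R : realType) T m K (I : fmnl R T m K) (eps tau : R) solve s s' :
  0 < eps -> node_solver I tau solve -> step I eps solve s s' ->
  potential eps s' <= potential eps s.
Proof.
move=> eps0 sol; case.
- move=> Q best cr N Q' /pops_sum sumQ _; rewrite /potential /= sumQ.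
  by have := node_weight_ge1 eps N; lra.
- move=> Q best cr N Q' UN x /pops_sum sumQ _ _ _; rewrite /potential /= sumQ.
  by have := node_weight_ge1 eps N; lra.
- move=> Q best cr N Q' UN x t N1 N2 /pops_sum sumQ sN _ big _ bis.
  have := sol N; rewrite sN => -[xN _ _].
  have [|w1 w2] := node_weight_bisect eps0 _ bis.
    exact: lt_le_trans big (gap_le_area t xN).
  rewrite /potential /= !big_cons sumQ w1 w2 -addn2 natrD; lra.
Qed.

Lemma exists_pops (R : realType) T m (solve : node R T -> option (R * cone_point R T m)) Q :
  ~~ nilp Q -> exists N Q', pops solve Q N Q'.
Proof.
elim: Q => // M Q IH _; have [/nilP Qnil|] := boolP (nilp Q).
  rewrite Qnil; exists M, [::]; split; first by exists [::], [::].
  by move=> M' [<-|[]].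
move/IH => [N [_ [[Q1 [Q2 [QE _]]] maxN]]].
have [le|lt] := leP (node_bound solve M) (node_bound solve N).
  exists N, (M :: Q1 ++ Q2); split; first by exists (M :: Q1), Q2; rewrite QE.
  by move=> M' [<-//|inM']; apply: maxN.
exists M, Q; split; first by exists [::], Q.
move=> M' [<-//|inM']; exact: le_trans (maxN _ inM') (ltW lt).
Qed.

Lemma exists_bisect (R : realType) T (N : node R T) t : exists N1 N2, bisect N t N1 N2.
Proof.
have [le|/ltW le] := leP (z_width N t) (theta_width N t).
  by do 2 eexists; apply: BisectTheta.
by do 2 eexists; apply: BisectZ.
Qed.

(** No queued node gets the algorithm stuck: the finite queue has a node with
    the best bound, an infeasible relaxation has bound [-oo] and is discarded,
    and a largest gap exists among the segments. *)
Lemma step_progress (R : realType) T m K (I : fmnl R T m K) (eps : R) solve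
    (s : state R T m) :
  ~~ halted s -> exists s', step I eps solve s s'.
Proof.
case: s => Q best cr [] //; rewrite /halted /= => Q0.
have [N [Q' popN]] := exists_pops solve Q0.
have [le|] := leP (node_bound solve N) (incumbent_value I best).
  by eexists; apply: StepDiscard popN le.
rewrite /node_bound; case sN: (solve N) => [[UN x]|]; last by rewrite ltNge leNye.
move=> lt; have [small|] := boolP [forall t, gap x t <= eps].
  by eexists; apply: StepStop popN sN lt (fun t => forallP small t).
rewrite negb_forall => /existsP[t0]; rewrite -ltNge => big0.
have [t tmax] : exists t, forall t', gap x t' <= gap x t.
  by exists [arg max_(t > t0) gap x t]%O; case: arg_maxP => // t _ maxt t'; apply: maxt.
have [N1 [N2 bis]] := exists_bisect N t.
by eexists; apply: StepBranch popN sN lt (lt_le_trans big0 (tmax _)) tmax bis.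
Qed.

(** The general tool for runs of the algorithm: it reduces a claim about
    halted states to an invariant of [step], with the potential bound for free.
    Popping shortens the queue by one; branching lengthens it by one but uses up
    two of the at most [b] nodes that can ever be created, hence the measure
    [2 * (b - size (created s)) + size (queue s)]. *)
Lemma bb_terminates_invariant (R : realType) T m K (I : fmnl R T m K) (eps tau : R)
    solve (P Q : state R T m -> Prop) :
  0 < eps -> node_solver I tau solve ->
  P (init_state I) -> (forall s s', P s -> step I eps solve s s' -> P s') ->
  (forall s, halted s -> P s -> potential eps s <= potential eps (init_state I) -> Q s) ->
  bb_terminates I eps solve Q.
Proof.
move=> eps0 sol P0 Pstep PQ; rewrite /bb_terminates.
set pot0 := potential eps (init_state I).
pose b := (Num.truncn pot0).+1.
have created_le_b (s : state R T m) : potential eps s <= pot0 -> (size (created s) <= b)%N.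
  move=> le; rewrite -(ler_nat R); apply: le_trans (created_le_potential eps s) _.
  by apply: le_trans le _; apply: ltW; apply: truncnS_gt.
suff main k s : (2 * (b - size (created s)) + size (queue s) < k)%N ->
    potential eps s <= pot0 -> P s -> terminates_with I eps solve Q s.
  exact: main (ltnSn _) (lexx _) P0.
elim: k s => // k IH s; rewrite ltnS => meas pots Ps.
have [h|nh] := boolP (halted s); first by apply: TerminatesHalt => //; apply: PQ.
apply: TerminatesStep => //; first exact: step_progress.
move=> s' st; have pots' := le_trans (potential_step eps0 sol st) pots.
apply: (IH s' _ pots' (Pstep _ _ Ps st)); apply: leq_trans meas.
have {pots'} := created_le_b _ pots'.
case: s s' / st {Ps pots nh} => /=.
- by move=> Qs best cr N Q' /pops_size -> _ _; rewrite addnS.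
- by move=> Qs best cr N Q' UN x /pops_size -> _ _ _ _; rewrite addnS.
- by move=> Qs best cr N Q' UN x t N1 N2 /pops_size -> _ _ _ _ _; lia.
Qed.

(** The constant in front of [(1 / eps) ^+ T]: the root weighs at most
    [((1 + 2 * `|W|) / eps) ^+ T], and a binary tree has fewer than twice as many
    nodes as leaves. *)
Definition node_const (R : realType) (W : R) T : R := 2 * (1 + 2 * `|W|) ^+ T.

Lemma root_potential_le (R : realType) T m K (I : fmnl R T m K) (W eps : R) :
  root_area_le W I -> 0 < eps <= 1 ->
  potential eps (init_state I) <= node_const W T * (1 / eps) ^+ T.
Proof.
move=> areaW /andP[eps0 eps1].
have weight_le : node_weight eps (root_node I) <= ((1 + 2 * `|W|) * (1 / eps)) ^+ T.
  rewrite -[X in _ ^+ X]card_ord -prodr_const; apply: ler_prod => t _.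
  rewrite le_max ler01 ge_max mul1r /=; apply/andP; split.
    by rewrite ler_pdivlMr // mul1r; have := normr_ge0 W; lra.
  rewrite ler_pM2r ?invr_gt0 //; have : area (root_node I) t <= W := areaW t.
  by have := ler_norm W; lra.
rewrite /node_const -mulrA -exprMn /potential /= big_seq1; lra.
Qed.

Lemma terminates_size (R : realType) T m K (I : fmnl R T m K) (W eps tau : R) solve :
  root_area_le W I -> 0 < eps <= 1 -> node_solver I tau solve ->
  bb_terminates I eps solve
    (fun s => (size (created s))%:R <= node_const W T * (1 / eps) ^+ T).
Proof.
move=> areaW eps01 sol; have /andP[eps0 _] := eps01.
apply: (bb_terminates_invariant (P := fun=> True) eps0 sol) => // s _ _ pots.
apply: le_trans (created_le_potential eps s) (le_trans pots _).
exact: root_potential_le.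
Qed.

Lemma terminates_with_weaken (R : realType) T m K (I : fmnl R T m K) (eps : R) solve
    (P Q : state R T m -> Prop) s :
  (forall s, P s -> Q s) -> terminates_with I eps solve P s ->
  terminates_with I eps solve Q s.
Proof.
move=> PQ; elim=> {}s; first by move=> h Ps; apply: TerminatesHalt => //; apply: PQ.
by move=> nh prog _ IH; apply: TerminatesStep.
Qed.

(** * Prices and points of the relaxations *)

Lemma expR_util (R : realType) T m K (I : fmnl R T m K) t i p :
  expR (util I t i - sens I i * p) = expR (util I t i) * expR (- (sens I i * p)).
Proof. exact: expRD. Qed.

Lemma sales_denE (R : realType) T m K (I : fmnl R T m K) p t :
  sales_den I p t = 1 + \sum_j expR (util I t j) * expR (- (sens I j * p j)).
Proof. by congr (1 + _); apply: eq_bigr => j _; apply: expR_util. Qed.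

Lemma sales_den_ge1 (R : realType) T m K (I : fmnl R T m K) p t :
  1 <= sales_den I p t.
Proof. by rewrite lerDl; apply: sumr_ge0 => i _; apply: expR_ge0. Qed.

Lemma relax_u_gt0 (R : realType) T m K (I : fmnl R T m K) N x i :
  relax_feasible I N x -> 0 < pt_u x i.
Proof. by case=> _ /(_ i)/andP[lo _] _ _ _; apply: lt_le_trans lo; apply: expR_gt0. Qed.

Lemma expR_price_of (R : realType) T m K (I : fmnl R T m K) N x i :
  wf_instance I -> relax_feasible I N x ->
  expR (- (sens I i * price_of I x i)) = pt_u x i.
Proof.
case=> _ _ b0 _ _ feas; rewrite /price_of mulrC divfK ?gt_eqF // opprK lnK //.
by rewrite posrE (relax_u_gt0 i feas).
Qed.

(** For [u > 0], membership of [(- s, u, 1)] in the exponential cone says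
    [s >= u * ln u], and [- (u * ln u) / b] is price times [u]. *)
Lemma sales_num_price_of (R : realType) T m K (I : fmnl R T m K) N x t :
  wf_instance I -> relax_feasible I N x -> pt_y x t <= sales_num I (price_of I x) t.
Proof.
move=> wf feas; have [[ys _ _ cone] _ _ _ _] := feas; have [_ _ b0 _ _] := wf.
apply: le_trans (ys t) _; apply: ler_sum => i _.
rewrite expR_util (expR_price_of _ wf feas).
have u0 := relax_u_gt0 i feas; have [_ + _] := cone i.
case=> [[_ us]|[u0' _ _]]; last by move: u0; rewrite u0' ltxx.
have le_s : pt_u x i * ln (pt_u x i) <= pt_s x i.
  rewrite mulrC -ler_pdivlMr // -[leRHS]opprK lerNr -lnV ?posrE //.
  rewrite -mulNr -ler_expR lnK ?posrE ?invr_gt0 //.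
  by rewrite -[leRHS]mul1r ler_pdivlMr // mulrC.
rewrite /price_of.
have -> : - ln (pt_u x i) / sens I i * (expR (util I t i) * pt_u x i) =
  - (expR (util I t i) / sens I i) * (pt_u x i * ln (pt_u x i)) by ring.
by rewrite ler_wnM2l // oppr_le0 divr_ge0 ?expR_ge0 // ltW.
Qed.

Lemma sales_den_price_of (R : realType) T m K (I : fmnl R T m K) N x t :
  wf_instance I -> relax_feasible I N x -> sales_den I (price_of I x) t <= pt_z x t.
Proof.
move=> wf feas; have [[_ zs _ _] _ _ _ _] := feas.
rewrite sales_denE; under eq_bigr do rewrite (expR_price_of _ wf feas).
exact: zs.
Qed.

(** The relaxation constrains [v], whereas the price is computed from [u].  As
    [ln u_i >= v_i], the price is at most [- v_i / b_i], and nonnegative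
    coefficients carry the linear constraints over to smaller prices; the box
    constraints come from the global bounds on [u]. *)
Lemma feasible_price_of (R : realType) T m K (I : fmnl R T m K) N x :
  wf_instance I -> relax_feasible I N x -> feasible_price I (price_of I x).
Proof.
move=> wf feas; have [[_ _ lin cone] ub _ _ _] := feas.
have [_ _ b0 alpha0 _] := wf; split=> [i|k].
  have /andP[] := ub i; rewrite -(expR_price_of i wf feas) !ler_expR !lerN2.
  by rewrite !ler_pM2l // => -> ->.
apply: le_trans (lin k); apply: ler_sum => i _.
have [_ _] := cone i; case=> [[_]|[/eqP]]; last by rewrite oner_eq0.
rewrite mul1r divr1 -(expR_price_of i wf feas) ler_expR => v.
rewrite -mulrA ler_wpM2l // mulrC ler_pdivlMr //; lra.
Qed.

Definition lift_price (R : realType) T m K (I : fmnl R T m K) (q : 'I_m -> R)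
  : cone_point R T m := {|
  pt_u := fun i => expR (- (sens I i * q i));
  pt_s := fun i => expR (- (sens I i * q i)) * - (sens I i * q i);
  pt_v := fun i => - (sens I i * q i);
  pt_y := sales_num I q;
  pt_z := sales_den I q;
  pt_theta := fun t => sales_num I q t / sales_den I q t
|}.

Definition in_box (R : realType) T m (N : node R T) (x : cone_point R T m) : Prop :=
  (forall t, theta_lo N t <= pt_theta x t <= theta_hi N t) /\
  (forall t, z_lo N t <= pt_z x t <= z_hi N t).

Lemma sales_num_lift (R : realType) T m K (I : fmnl R T m K) q t :
  wf_instance I -> sales_num I q t =
  \sum_i (- (expR (util I t i) / sens I i)) * pt_s (lift_price I q) i.
Proof.
case=> _ _ b0 _ _; apply: eq_bigr => i _; rewrite expR_util /=.
by field; rewrite gt_eqF.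
Qed.

Lemma conic_feasible_lift (R : realType) T m K (I : fmnl R T m K) q :
  wf_instance I -> feasible_price I q -> conic_feasible I (lift_price I q).
Proof.
move=> wf [qb qlin]; have [_ _ b0 _ _] := wf; split=> [t|t|k|i] /=.
- by rewrite (sales_num_lift _ _ wf).
- by rewrite sales_denE.
- apply: le_trans (qlin k); rewrite le_eqVlt; apply/orP; left; apply/eqP.
  by apply: eq_bigr => i _; field; rewrite gt_eqF.
- have /andP[lo hi] := qb i; split.
  + by rewrite !lerN2 !ler_pM2l // lo hi.
  + left; split; first exact: expR_gt0.
    rewrite mulrN opprK mulrAC divff ?gt_eqF ?expR_gt0 // mul1r.
    by rewrite -expRD addNr expR0.
  + by left; split => //; rewrite mul1r divr1.
Qed.

Lemma root_u_lift (R : realType) T m K (I : fmnl R T m K) q i :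
  wf_instance I -> feasible_price I q ->
  root_u_lo I i <= pt_u (lift_price I q) i <= root_u_hi I i.
Proof.
case=> _ _ b0 _ _ [/(_ i)/andP[lo hi] _].
by rewrite /= /root_u_lo /root_u_hi !ler_expR !lerN2 !ler_pM2l // lo hi.
Qed.

(** The lift satisfies [y = theta * z] exactly, so each McCormick inequality
    reduces to the sign of a product of two distances to box sides. *)
Lemma relax_feasible_lift (R : realType) T m K (I : fmnl R T m K) N q :
  wf_instance I -> feasible_price I q -> in_box N (lift_price I q) ->
  relax_feasible I N (lift_price I q).
Proof.
move=> wf fq [thb zb]; split=> //; first exact: conic_feasible_lift.
  by move=> i; apply: root_u_lift.
move=> t; have /andP[th1 th2] := thb t; have /andP[z1 z2] := zb t.
have -> : pt_y (lift_price I q) t =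
    pt_theta (lift_price I q) t * pt_z (lift_price I q) t.
  by rewrite /= divfK // gt_eqF // (lt_le_trans _ (sales_den_ge1 I q t)).
by split; nra.
Qed.

Lemma objective_lift (R : realType) T m K (I : fmnl R T m K) q :
  objective I (lift_price I q) = revenue I q.
Proof. by []. Qed.

Definition entropies (R : realType) T m K (I : fmnl R T m K) i : set R :=
  [set u * ln u | u in `[root_u_lo I i, root_u_hi I i]]%classic.

(** On this interval [u = exp (- b * p)] with [p] between the price bounds, so
    [u * ln u = - b * p * u].  Keeping the factor [b] visible matters: it cancels
    the division by [b] in the bounds on [y], which thus stay bounded as [b]
    tends to [0]. *)
Lemma entropies_bound (R : realType) T m K (I : fmnl R T m K) i (M : R) e :
  wf_instance I -> `|pmin I i| <= M -> `|pmax I i| <= M -> entropies I i e ->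
  `|e| <= root_u_hi I i * (sens I i * M).
Proof.
case=> _ _ b0 _ _ Lb Ub [u /= ]; rewrite in_itv /= => /andP[lo hi] <-.
have u0 : 0 < u by apply: lt_le_trans lo; apply: expR_gt0.
rewrite normrM; apply: ler_pM => //; first by rewrite ger0_norm // ltW.
have b0i := b0 i.
have {}lo : - (sens I i * pmax I i) <= ln u by rewrite -ler_expR lnK ?posrE.
have {}hi : ln u <= - (sens I i * pmin I i) by rewrite -ler_expR lnK ?posrE.
move: Lb Ub; rewrite !ler_norml => /andP[L1 L2] /andP[U1 U2].
by apply/andP; split; nra.
Qed.

Lemma entropies_bounds (R : realType) T m K (I : fmnl R T m K) i e :
  wf_instance I -> entropies I i e -> root_s_lo I i <= e <= root_s_hi I i.
Proof.
move=> wf ei; pose M := `|pmin I i| + `|pmax I i|.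
have LM : `|pmin I i| <= M by rewrite lerDl.
have UM : `|pmax I i| <= M by rewrite lerDr.
apply/andP; split; [apply: ge_inf ei | apply: ub_le_sup ei];
  [exists (- (root_u_hi I i * (sens I i * M))) | exists (root_u_hi I i * (sens I i * M))];
  by move=> e' /(entropies_bound wf LM UM); rewrite ler_norml => /andP[].
Qed.

Lemma lift_entropy (R : realType) T m K (I : fmnl R T m K) q i :
  wf_instance I -> feasible_price I q -> entropies I i (pt_s (lift_price I q) i).
Proof.
move=> wf fq; exists (pt_u (lift_price I q) i); last by rewrite /= expRK.
by rewrite /= in_itv /=; apply: root_u_lift.
Qed.

Lemma root_y_lift (R : realType) T m K (I : fmnl R T m K) q t :
  wf_instance I -> feasible_price I q ->
  root_y_lo I t <= sales_num I q t <= root_y_hi I t.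
Proof.
move=> wf fq; rewrite (sales_num_lift _ _ wf); have [_ _ b0 _ _] := wf.
have coef0 i : - (expR (util I t i) / sens I i) <= 0.
  by rewrite oppr_le0 divr_ge0 ?expR_ge0 // ltW.
by apply/andP; split; apply: ler_sum => i _; apply: ler_wnM2l => //;
  have /andP[] := entropies_bounds wf (lift_entropy i wf fq).
Qed.

Lemma root_z_lift (R : realType) T m K (I : fmnl R T m K) q t :
  wf_instance I -> feasible_price I q ->
  root_z_lo I t <= sales_den I q t <= root_z_hi I t.
Proof.
move=> wf fq; rewrite sales_denE.
by apply/andP; split; rewrite lerD2l; apply: ler_sum => i _;
  rewrite ler_wpM2l ?expR_ge0 //; have /andP[] := root_u_lift i wf fq.
Qed.

Lemma root_z_lo_ge1 (R : realType) T m K (I : fmnl R T m K) t : 1 <= root_z_lo I t.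
Proof. by rewrite lerDl; apply: sumr_ge0 => i _; rewrite mulr_ge0 ?expR_ge0. Qed.

(** A negative lower end of the numerator is to be divided by the smallest
    denominator and a nonnegative one by the largest; the upper end is treated
    the other way round. *)
Lemma interval_division (R : realType) (y yl yh z zl zh : R) :
  yl <= y <= yh -> zl <= z <= zh -> 0 < zl ->
  Num.min (yl / zl) (yl / zh) <= y / z <= Num.max (yh / zl) (yh / zh).
Proof.
move=> /andP[y1 y2] /andP[z1 z2] zl0.
have z0 : 0 < z by exact: lt_le_trans z1.
have zh0 : 0 < zh by exact: lt_le_trans z2.
have i1 : zh^-1 <= z^-1 by rewrite lef_pV2 ?posrE.
have i2 : z^-1 <= zl^-1 by rewrite lef_pV2 ?posrE.
have i0 : 0 < zh^-1 by rewrite invr_gt0.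
rewrite ge_min le_max; apply/andP; split; apply/orP.
- have [yl0|/ltW yl0] := leP 0 yl; [right|left]; nra.
- have [yh0|/ltW yh0] := leP 0 yh; [left|right]; nra.
Qed.

Lemma root_in_box (R : realType) T m K (I : fmnl R T m K) q :
  wf_instance I -> feasible_price I q -> in_box (root_node I) (lift_price I q).
Proof.
move=> wf fq; split=> t; last exact: root_z_lift.
apply: interval_division; [exact: root_y_lift|exact: root_z_lift|].
exact: lt_le_trans (root_z_lo_ge1 I t).
Qed.

Lemma in_box_bisect (R : realType) T m (N N1 N2 : node R T) t (x : cone_point R T m) :
  bisect N t N1 N2 -> in_box N x -> in_box N1 x \/ in_box N2 x.
Proof.
case=> _ c [thb zb].
- have [le|/ltW le] := leP (pt_theta x t) c; [left|right]; split=> //= t';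
    have /andP[th1 th2] := thb t'; rewrite /set_at; case: eqP => [->|_];
    by rewrite ?le ?th1 ?th2 ?andbT //; have /andP[] := thb t.
- have [le|/ltW le] := leP (pt_z x t) c; [left|right]; split=> //= t';
    have /andP[th1 th2] := zb t'; rewrite /set_at; case: eqP => [->|_];
    by rewrite ?le ?th1 ?th2 ?andbT //; have /andP[] := zb t.
Qed.

(** * Optimality of the output *)

Lemma sales_den_lower (R : realType) T m K (I : fmnl R T m.+1 K) (B : R) p t :
  wf_instance I -> bounded_data B I -> feasible_price I p ->
  1 + expR (- (B + B * B)) <= sales_den I p t.
Proof.
case=> _ _ b0 _ _ [utilB dataB] [/(_ ord0)/andP[_ pU] _].
rewrite lerD2l big_ord_recl; apply: ler_wpDr.
  by apply: sumr_ge0 => i _; apply: expR_ge0.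
have [sB _ UB] := dataB ord0; have := utilB t ord0; have b0i := b0 ord0.
move: sB UB; rewrite ler_expR !ler_norml => /andP[_ s2] /andP[_ U2] /andP[u1 _].
have B0 : 0 < B by exact: lt_le_trans s2.
have : sens I ord0 * p ord0 <= B * B.
  apply: (@le_trans _ _ (sens I ord0 * B)); last by rewrite ler_pM2r.
  by rewrite ler_pM2l //; apply: le_trans pU U2.
lra.
Qed.

(** With [h] the lower bound of [sales_den_lower] on the exponentials, this is
    [1 - 1 / (1 + h)], the fraction of [eps] not consumed by the gaps. *)
Definition accuracy_ratio (R : realType) (B : R) : R :=
  let h := expR (- (B + B * B)) in h / (1 + h).

Lemma accuracy_ratio_gt0 (R : realType) (B : R) : 0 < accuracy_ratio B.
Proof. by rewrite divr_gt0 ?expR_gt0 // ltr_wpDl ?expR_gt0. Qed.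

(** Both error sources fit into [eps]: gaps of at most [eps] cost
    [eps / (1 + h)] and the solver costs [tau].  Nonnegative sales are essential:
    they make the ratio decrease when [z_t] is increased above the denominator. *)
Lemma stop_revenue (R : realType) T m K (I : fmnl R T m K) (B eps tau UN : R) N x q :
  wf_instance I -> nonneg_sales I -> bounded_data B I -> 0 < eps ->
  tau <= accuracy_ratio B * eps ->
  relax_feasible I N x -> (forall t, gap x t <= eps) -> UN - tau <= objective I x ->
  revenue I q <= UN ->
  revenue I q - eps <= revenue I (price_of I x).
Proof.
case: m I x q => [|m] I x q wf nneg bd eps0 taule feas gaps obj leU.
  (* Without products there is only one price vector. *)
  have -> : q = price_of I x by apply/funext => -[].
  by rewrite gerBl ltW.
set h := expR (- (B + B * B)); have h0 : 0 < h by apply: expR_gt0.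
have h10 : 0 < 1 + h by lra.
set p := price_of I x; have fp : feasible_price I p := feasible_price_of wf feas.
have theta_le t : pt_theta x t <= sales_num I p t / sales_den I p t + eps / (1 + h).
  have den_h : 1 + h <= sales_den I p t := sales_den_lower t wf bd fp.
  have den0 : 0 < sales_den I p t by exact: lt_le_trans den_h.
  have num0 := nneg p t fp.
  have y_le := sales_num_price_of t wf feas; have z_ge := sales_den_price_of t wf feas.
  have := gaps t; rewrite /gap ler_norml => /andP[gt _].
  have z0 : 0 < pt_z x t by exact: lt_le_trans z_ge.
  apply: (@le_trans _ _ ((sales_num I p t + eps) / sales_den I p t)).
    apply: (@le_trans _ _ ((sales_num I p t + eps) / pt_z x t)).
      by rewrite ler_pdivlMr //; lra.
    by rewrite ler_wpM2l ?lef_pV2 ?posrE //; lra.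
  by rewrite mulrDl lerD2l ler_pM2l // lef_pV2 ?posrE.
have obj_le : objective I x <= revenue I p + eps / (1 + h).
  have [d0 d1 _ _ _] := wf.
  have -> : eps / (1 + h) = \sum_t weight I t * (eps / (1 + h)).
    by rewrite -mulr_suml d1 mul1r.
  rewrite -big_split /=.
  by apply: ler_sum => t _; rewrite -mulrDr ler_pM2l.
have split_eps : eps / (1 + h) + accuracy_ratio B * eps = eps.
  by rewrite /accuracy_ratio -/h; field; lra.
lra.
Qed.

(** The two cases differ because an early stop abandons the boxes that are still
    queued: before it, no feasible price is lost without an incumbent at least as
    good; after it, only the tolerance [eps] is left of this guarantee. *)
Definition sound (R : realType) T m K (I : fmnl R T m K) (eps : R) (s : state R T m) :=
  (forall p, incumbent s = Some p -> feasible_price I p) /\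
  forall q, feasible_price I q ->
    if stopped s then ((revenue I q - eps)%:E <= incumbent_value I (incumbent s))%E : Prop
    else ((revenue I q)%:E <= incumbent_value I (incumbent s))%E \/
         exists N, List.In N (queue s) /\ in_box N (lift_price I q).

Lemma update_incumbentP (R : realType) T m K (I : fmnl R T m K) best p :
  (incumbent_value I best <= incumbent_value I (update_incumbent I best p))%E /\
  ((revenue I p)%:E <= incumbent_value I (update_incumbent I best p))%E.
Proof.
by rewrite /update_incumbent; have [lt|le] := ltP (incumbent_value I best) (revenue I p)%:E;
  split=> //; apply: ltW.
Qed.

Lemma update_incumbent_feasible (R : realType) T m K (I : fmnl R T m K) best p :
  (forall p', best = Some p' -> feasible_price I p') -> feasible_price I p ->
  forall p', update_incumbent I best p = Some p' -> feasible_price I p'.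
Proof. by rewrite /update_incumbent; case: ifP => // _ _ fp p' [<-]. Qed.

Lemma pops_in (R : realType) T m (solve : node R T -> option (R * cone_point R T m))
    Q N Q' M : pops solve Q N Q' -> List.In M Q -> M = N \/ List.In M Q'.
Proof.
case=> -[Q1 [Q2 [-> ->]]] _ /List.in_app_iff[in1|[->|in2]]; first [by left | right].
- by apply/List.in_app_iff; left.
- by apply/List.in_app_iff; right.
Qed.

Lemma revenue_le_bound (R : realType) T m K (I : fmnl R T m K) (tau : R) solve N q :
  wf_instance I -> node_solver I tau solve -> feasible_price I q ->
  in_box N (lift_price I q) -> ((revenue I q)%:E <= node_bound solve N)%E.
Proof.
move=> wf sol fq /(relax_feasible_lift wf fq) feas; rewrite /node_bound.
have := sol N; case: (solve N) => [[UN x] [_ _ ub]|/(_ _ feas) //].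
by rewrite lee_fin -objective_lift; apply: ub.
Qed.

(** A discarded node had a bound at most the incumbent value; a branched box passes
    each of its points on to a child; and at an early stop the popped bound is
    the largest in the queue, hence at least the revenue of every price whose
    lift is still in a queued box. *)
Lemma sound_step (R : realType) T m K (I : fmnl R T m K) (B eps tau : R) solve s s' :
  wf_instance I -> nonneg_sales I -> bounded_data B I -> 0 < eps ->
  tau <= accuracy_ratio B * eps -> node_solver I tau solve ->
  sound I eps s -> step I eps solve s s' -> sound I eps s'.
Proof.
move=> wf nneg bd eps0 taule sol snd st; case: s s' / st snd.
- move=> Q best cr N Q' popN discard [/= fbest cov]; split=> //= q fq.
  have [le|[M [inM boxM]]] := cov q fq; first by left.
  have [MN|inM'] := pops_in popN inM; last by right; exists M.
  by left; apply: le_trans discard; rewrite -MN; exact: revenue_le_bound wf sol fq boxM.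
- move=> Q best cr N Q' UN x popN sN lt small [/= fbest cov].
  have := sol N; rewrite sN => -[feas obj _].
  have fx := feasible_price_of wf feas.
  split=> /= [|q fq]; first exact: update_incumbent_feasible.
  have [le_best le_new] := update_incumbentP I best (price_of I x).
  have [le|[M [inM boxM]]] := cov q fq.
    apply: le_trans le_best; apply: le_trans le; rewrite lee_fin; lra.
  apply: le_trans le_new; rewrite lee_fin.
  apply: stop_revenue feas small obj _ => //; try eassumption.
  rewrite -lee_fin; apply: le_trans (revenue_le_bound wf sol fq boxM) _.
  by have [_ /(_ M inM)] := popN; rewrite [X in (_ <= X)%E]/node_bound sN.
- move=> Q best cr N Q' UN x t N1 N2 popN sN lt big tmax bis [/= fbest cov].
  have := sol N; rewrite sN => -[feas obj _].
  have fx := feasible_price_of wf feas.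
  split=> /= [|q fq]; first exact: update_incumbent_feasible.
  have [le_best _] := update_incumbentP I best (price_of I x).
  have [le|[M [inM boxM]]] := cov q fq; first by left; apply: le_trans le_best.
  right; have [MN|inM'] := pops_in popN inM; last by exists M; split=> //; right; right.
  rewrite MN in boxM; have [box1|box2] := in_box_bisect bis boxM.
    by exists N1; split=> //; left.
  by exists N2; split=> //; right; left.
Qed.

Lemma sound_init (R : realType) T m K (I : fmnl R T m K) (eps : R) :
  wf_instance I -> sound I eps (init_state I).
Proof.
move=> wf; split=> //= q fq; right; exists (root_node I); split; first by left.
exact: root_in_box.
Qed.

Lemma sound_halted (R : realType) T m K (I : fmnl R T m K) (eps : R) s :
  wf_instance I -> 0 < eps -> halted s -> sound I eps s -> outputs_eps_optimal I eps s.
Proof.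
case=> _ _ _ _ [q0 fq0] eps0 halt [fbest cov].
have {cov}near_opt q : feasible_price I q ->
    ((revenue I q - eps)%:E <= incumbent_value I (incumbent s))%E.
  move=> fq; have := cov q fq; move: halt; rewrite /halted.
  case: (stopped s) => //= /nilP ->; case=> [le|[N [[]]]].
  by apply: le_trans le; rewrite lee_fin; lra.
rewrite /outputs_eps_optimal.
case best: (incumbent s) => [p|]; last by have := near_opt q0 fq0; rewrite best.
split; first exact: fbest.
by move=> q /near_opt; rewrite best lee_fin.
Qed.

Lemma terminates_eps_optimal (R : realType) T m K (I : fmnl R T m K) (B eps tau : R) solve :
  wf_instance I -> nonneg_sales I -> bounded_data B I -> 0 < eps ->
  tau <= accuracy_ratio B * eps -> node_solver I tau solve ->
  bb_terminates I eps solve (outputs_eps_optimal I eps).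
Proof.
move=> wf nneg bd eps0 taule sol.
apply: (bb_terminates_invariant eps0 sol (sound_init eps wf)).
  by move=> s s'; exact: (sound_step wf nneg bd eps0 taule sol).
by move=> s halt snd _; apply: sound_halted.
Qed.

(** * The root box of an instance with bounded data *)

Lemma root_s_bound (R : realType) T m K (I : fmnl R T m K) i (M : R) :
  wf_instance I -> `|pmin I i| <= M -> `|pmax I i| <= M ->
  let X := root_u_hi I i * (sens I i * M) in
  `|root_s_lo I i| <= X /\ `|root_s_hi I i| <= X.
Proof.
move=> wf LM UM X; have [_ _ _ _ [q fq]] := wf.
have inhab := lift_entropy i wf fq.
have bound e : entropies I i e -> - X <= e <= X.
  by move=> /(entropies_bound wf LM UM); rewrite ler_norml.
have /andP[lo hi] := entropies_bounds wf inhab.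
have /andP[qlo qhi] := bound _ inhab.
have inf_ge : - X <= root_s_lo I i.
  by apply: lb_le_inf => [|e /bound/andP[]//]; exists (pt_s (lift_price I q) i).
have sup_le : root_s_hi I i <= X.
  by apply: ge_sup => [|e /bound/andP[]//]; exists (pt_s (lift_price I q) i).
by split; rewrite ler_norml; apply/andP; split; lra.
Qed.

Definition area_const (R : realType) (B : R) : R :=
  2 * (expR B * expR (B * B)) ^+ 2 * B.

(** The [m] summands of the [y] and [z] bounds are bounded in terms of [B]
    alone, and dividing by [z >= 1] does not enlarge the [theta] bounds. *)
Lemma root_area_quadratic (R : realType) T m K (I : fmnl R T m K) (B : R) :
  wf_instance I -> bounded_data B I -> root_area_le (area_const B * m%:R ^+ 2) I.
Proof.
move=> wf [utilB dataB] t; have [_ _ b0 _ [q fq]] := wf.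
have sens_bounds i : 0 < B /\ root_u_hi I i <= expR (B * B).
  have [] := dataB i; have b0i := b0 i; rewrite !ler_norml => /andP[_ s2] /andP[L1 _] _.
  have B0 : 0 < B by exact: lt_le_trans s2.
  split=> //; rewrite ler_expR -mulrN; apply: (@le_trans _ _ (sens I i * B)).
    by rewrite ler_pM2l //; lra.
  by rewrite ler_pM2r.
set E := expR B * expR (B * B).
have util_le i : expR (util I t i) <= expR B.
  by rewrite ler_expR; apply: le_trans (ler_norm _) (utilB t i).
have y_bound (s : 'I_m -> R) :
    (forall i, `|s i| <= root_u_hi I i * (sens I i * B)) ->
    `|\sum_i - (expR (util I t i) / sens I i) * s i| <= m%:R * (E * B).
  move=> sb; apply: le_trans (ler_norm_sum _ _ _) _.
  have -> : m%:R * (E * B) = \sum_(i < m) (E * B).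
    by rewrite sumr_const card_ord mulr_natl.
  apply: ler_sum => i _; have [B0 u_le] := sens_bounds i; have b0i := b0 i.
  rewrite normrM normrN (ger0_norm (divr_ge0 (expR_ge0 _) (ltW b0i))).
  apply: (@le_trans _ _ (expR (util I t i) / sens I i * (root_u_hi I i * (sens I i * B)))).
    by rewrite ler_wpM2l // divr_ge0 ?expR_ge0 // ltW.
  have -> : expR (util I t i) / sens I i * (root_u_hi I i * (sens I i * B)) =
    expR (util I t i) * root_u_hi I i * B by field; rewrite gt_eqF.
  by rewrite ler_pM2r //; apply: ler_pM; rewrite ?expR_ge0.
have s_bounds i : `|root_s_lo I i| <= root_u_hi I i * (sens I i * B) /\
    `|root_s_hi I i| <= root_u_hi I i * (sens I i * B).
  by have [_ LB UB] := dataB i; apply: root_s_bound.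
have ylo : `|root_y_lo I t| <= m%:R * (E * B).
  by apply: y_bound => i; have [] := s_bounds i.
have yhi : `|root_y_hi I t| <= m%:R * (E * B).
  by apply: y_bound => i; have [] := s_bounds i.
have zlo1 := root_z_lo_ge1 I t.
have /andP[z1 z2] := root_z_lift t wf fq.
have div_le (y z : R) : 1 <= z -> `|y| <= m%:R * (E * B) -> `|y / z| <= m%:R * (E * B).
  move=> zge1; apply: le_trans; rewrite normrM normfV ler_pdivrMr; last first.
    by rewrite gtr0_norm; lra.
  by rewrite ler_peMr // ger0_norm //; lra.
have zhi1 : 1 <= root_z_hi I t by lra.
have theta_le : theta_width (root_node I) t <= 2 * (m%:R * (E * B)).
  rewrite /theta_width /=.
  have := div_le _ _ zlo1 ylo; have := div_le _ _ zhi1 ylo.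
  have := div_le _ _ zlo1 yhi; have := div_le _ _ zhi1 yhi.
  rewrite !ler_norml => /andP[_ a] /andP[_ b] /andP[c _] /andP[d _].
  have : Num.max (root_y_hi I t / root_z_lo I t) (root_y_hi I t / root_z_hi I t) <= m%:R * (E * B).
    by rewrite ge_max b a.
  have : - (m%:R * (E * B)) <= Num.min (root_y_lo I t / root_z_lo I t) (root_y_lo I t / root_z_hi I t).
    by rewrite le_min d c.
  by lra.
have z_le : z_width (root_node I) t <= m%:R * E.
  rewrite /z_width /= /root_z_hi /root_z_lo.
  have lo0 : 0 <= \sum_i expR (util I t i) * root_u_lo I i.
    by apply: sumr_ge0 => i _; rewrite mulr_ge0 ?expR_ge0.
  have hi : \sum_i expR (util I t i) * root_u_hi I i <= m%:R * E.
    have -> : m%:R * E = \sum_(i < m) E by rewrite sumr_const card_ord mulr_natl.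
    by apply: ler_sum => i _; have [_ u_le] := sens_bounds i; apply: ler_pM; rewrite ?expR_ge0.
  lra.
have [/(_ t)/andP[th1 th2] _] := root_in_box wf fq.
apply: (@le_trans _ _ (2 * (m%:R * (E * B)) * (m%:R * E))).
  apply: ler_pM => //; rewrite subr_ge0; first exact: le_trans th2.
  exact: le_trans z2.
by rewrite le_eqVlt /area_const -/E; apply/orP; left; apply/eqP; ring.
Qed.

(** * Solver cost and total time *)

(** Since [tau >= eps / kappa] and [kappa <= 1 / eps], the Newton bound has
    [ln (1 / tau) <= 2 * ln (1 / eps)]. *)
Lemma node_cost_le (R : realType) (kappa : R) T m K n nu eps tau (newton ops : node R T -> nat) N :
  1 < kappa -> 0 < eps <= 1 / kappa ^+ 2 ->
  cost_model kappa m K n nu eps tau newton ops ->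
  (node_cost newton ops N)%:R
    <= 2 * kappa ^+ 3 * (n%:R ^+ 3 * Num.sqrt m%:R * ln (1 / eps)).
Proof.
move=> k1 /andP[eps0 epsk] [/andP[_ nu_m] _ /andP[tau_lo tau_hi] newtonN opsN].
have k0 : 0 < kappa by lra.
have kk0 : 0 < kappa ^+ 2 by rewrite exprn_gt0.
have tau0 : 0 < tau by apply: lt_le_trans tau_lo; rewrite divr_gt0.
have tau_small : tau <= 1 / kappa.
  apply: le_trans tau_hi _; rewrite -ler_pdivlMl //; apply: le_trans epsk _.
  by rewrite le_eqVlt; apply/orP; left; apply/eqP; field; lra.
have kappa_le : kappa <= 1 / eps.
  rewrite ler_pdivlMr // mulrC; move: epsk; rewrite ler_pdivlMr // expr2; nra.
have inv_eps : 1 <= 1 / eps by lra.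
have ln_tau : ln (1 / tau) <= 2 * ln (1 / eps).
  rewrite mulr_natl -lnXn ?divr_gt0 // ler_ln ?posrE ?divr_gt0 ?exprn_gt0 ?divr_gt0 //.
  apply: (@le_trans _ _ (kappa * (1 / eps))); last by rewrite expr2 ler_wpM2r // divr_ge0 // ltW.
  rewrite mulrA mulr1 ler_pdivlMr // mulrAC mul1r ler_pdivrMr //.
  by move: tau_lo; rewrite ler_pdivrMr // mulrC.
have ln0 : 0 <= ln (1 / eps) by rewrite ln_ge0.
have sqrt_nu : Num.sqrt nu%:R <= kappa * Num.sqrt m%:R.
  apply: (@le_trans _ _ (Num.sqrt (kappa ^+ 2 * m%:R))).
    rewrite ler_sqrt; last by rewrite mulr_ge0 // ltW.
    apply: le_trans nu_m _.
    by rewrite ler_wpM2r // expr2; nra.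
  by rewrite sqrtrM ?sqrtr_sqr ?gtr0_norm // ltW.
rewrite /node_cost natrM.
apply: (@le_trans _ _ ((kappa * (kappa * Num.sqrt m%:R * (2 * ln (1 / eps)))) * (kappa * n%:R ^+ 3))); last first.
  by rewrite le_eqVlt; apply/orP; left; apply/eqP; ring.
apply: ler_pM => //; apply: le_trans (newtonN tau_small N) _.
rewrite ler_pM2l //; apply: ler_pM => //.
by rewrite ln_ge0 // ler_pdivlMr // mul1r; apply: le_trans tau_small _; rewrite ler_pdivrMr //; lra.
Qed.

Lemma total_time_le (R : realType) T m (newton ops : node R T -> nat)
    (s : state R T m) (c : R) :
  (forall N, (node_cost newton ops N)%:R <= c) ->
  (total_time newton ops s)%:R <= (size (created s))%:R * c.
Proof.
move=> cost; rewrite /total_time natr_sum.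
elim: (created s) => [|N l IH]; first by rewrite big_nil mul0r.
rewrite big_cons -[size _]/(size l).+1 -natr1 mulrDl mul1r addrC; exact: lerD.
Qed.

Lemma powR_seven_halves (R : realType) (x : R) : 0 <= x -> x `^ (7 / 2) = x ^+ 3 * Num.sqrt x.
Proof.
move=> x0; have -> : 7 / 2 = 3%:R + 2^-1 :> R by field.
by rewrite powRD ?powR_mulrn ?powR12_sqrt //; apply/implyP => /eqP; lra.
Qed.

Lemma total_time_bound (R : realType) (kappa : R) T m K n nu eps tau W
    (I : fmnl R T m K) (newton ops : node R T -> nat) solve :
  1 < kappa -> root_area_le W I -> 0 < eps <= 1 / kappa ^+ 2 -> node_solver I tau solve ->
  cost_model kappa m K n nu eps tau newton ops ->
  bb_terminates I eps solve (fun s => (total_time newton ops s)%:R <=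
    node_const W T * (1 / eps) ^+ T *
      (2 * kappa ^+ 3 * (n%:R ^+ 3 * Num.sqrt m%:R * ln (1 / eps)))).
Proof.
move=> k1 areaW epsk sol cost; have /andP[eps0 eps_le] := epsk.
have eps1 : eps <= 1.
  by apply: le_trans eps_le _; rewrite ler_pdivrMr ?exprn_gt0 ?mul1r ?exprn_ege1 ?ltW //; lra.
have eps01 : 0 < eps <= 1 by rewrite eps0.
apply: terminates_with_weaken (terminates_size areaW eps01 sol) => s size_s.
have cost_s N := node_cost_le N k1 epsk cost.
apply: le_trans (total_time_le s cost_s) _; rewrite ler_wpM2r //.
by rewrite !mulr_ge0 ?exprn_ge0 ?sqrtr_ge0 ?ln_ge0 ?ler_pdivlMr ?mul1r //; lra.
Qed.

Lemma threshold_lt1 (R : realType) (kappa : R) : 1 < kappa -> 0 < 1 / kappa ^+ 2 < 1.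
Proof.
move=> k1; have kk1 : 1 < kappa ^+ 2 by rewrite exprn_egt1.
by rewrite divr_gt0 ?ltr_pdivrMr ?mul1r //; lra.
Qed.

Lemma node_const_mono (R : realType) (W W' : R) T T' :
  `|W| <= `|W'| -> (T <= T')%N -> node_const W T <= node_const W' T'.
Proof.
move=> WW' TT'; rewrite /node_const ler_pM2l //.
have w0 := normr_ge0 W.
apply: (@le_trans _ _ ((1 + 2 * `|W'|) ^+ T)); first by apply: lerXn2r; rewrite ?nnegrE; lra.
by apply: ler_weXn2l => //; lra.
Qed.

Lemma node_const_gt0 (R : realType) (W : R) T : 0 < node_const W T.
Proof. by rewrite mulr_gt0 // exprn_gt0 //; have := normr_ge0 W; lra. Qed.

Theorem theorem1 (R : realType) :
  (* termination with an eps-optimal solution *)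
  (forall B : R, exists c : R, 0 < c /\
    forall (T m K : nat) (I : fmnl R T m K) (eps tau : R)
           (solve : node R T -> option (R * cone_point R T m)),
      wf_instance I -> nonneg_sales I -> bounded_data B I ->
      0 < eps < 1 -> 0 < tau <= c * eps -> node_solver I tau solve ->
      bb_terminates I eps solve (outputs_eps_optimal I eps)) /\
  (* number of nodes times solver cost, for fixed T *)
  (forall kappa : R, 1 < kappa ->
    exists Csolver eps0 : R, [/\ 0 < Csolver, 0 < eps0 < 1 &
    forall (T : nat) (W : R), exists Cnodes : R, 0 < Cnodes /\
    forall (m K n nu : nat) (I : fmnl R T m K) (eps tau : R)
           (solve : node R T -> option (R * cone_point R T m))
           (newton ops : node R T -> nat),
      wf_instance I -> root_area_le W I ->
      0 < eps < 1 -> 0 < tau -> node_solver I tau solve ->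
      cost_model kappa m K n nu eps tau newton ops ->
      bb_terminates I eps solve (fun s =>
        (size (created s))%:R <= Cnodes * (1 / eps) ^+ T /\
        (eps <= eps0 ->
         (forall N, (node_cost newton ops N)%:R
            <= Csolver * (n%:R ^+ 3 * Num.sqrt m%:R * ln (1 / eps))) /\
         (total_time newton ops s)%:R
            <= (Cnodes * (1 / eps) ^+ T)
               * (Csolver * (n%:R ^+ 3 * Num.sqrt m%:R * ln (1 / eps)))))]) /\
  (* K = O(m) and T bounded *)
  (forall (kappa rho W : R) (T0 : nat), 1 < kappa -> 0 < rho ->
    exists C eps0 : R, [/\ 0 < C, 0 < eps0 < 1 &
    forall (T m K n nu : nat) (I : fmnl R T m K) (eps tau : R)
           (solve : node R T -> option (R * cone_point R T m))
           (newton ops : node R T -> nat),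
      (T <= T0)%N -> K%:R <= rho * m%:R -> wf_instance I -> root_area_le W I ->
      0 < eps <= eps0 -> 0 < tau -> node_solver I tau solve ->
      cost_model kappa m K n nu eps tau newton ops ->
      bb_terminates I eps solve (fun s =>
        (total_time newton ops s)%:R
          <= C * ((1 / eps) ^+ T * m%:R `^ (7 / 2) * ln (1 / eps)))]) /\
  (* polynomial time in the problem size and 1 / eps for bounded T *)
  (forall T0 : nat, exists q : nat, forall kappa B : R, 1 < kappa ->
    exists C eps0 : R, [/\ 0 < C, 0 < eps0 < 1 &
    forall (T m K n nu : nat) (I : fmnl R T m K) (eps tau : R)
           (solve : node R T -> option (R * cone_point R T m))
           (newton ops : node R T -> nat),
      (T <= T0)%N -> wf_instance I -> bounded_data B I ->
      0 < eps <= eps0 -> 0 < tau -> node_solver I tau solve ->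
      cost_model kappa m K n nu eps tau newton ops ->
      bb_terminates I eps solve (fun s =>
        (total_time newton ops s)%:R <= C * ((m + K)%:R + 1 / eps) ^+ q)]).
Proof.
split; [|split; [|split]].
- move=> B; exists (accuracy_ratio B); split; first exact: accuracy_ratio_gt0.
  move=> T m K I eps tau solve wf nneg bd /andP[eps0 _] /andP[_ taule] sol.
  exact: terminates_eps_optimal wf nneg bd eps0 taule sol.
- move=> kappa k1; exists (2 * kappa ^+ 3), (1 / kappa ^+ 2); split.
  + by rewrite mulr_gt0 // exprn_gt0 //; lra.
  + exact: threshold_lt1.
  move=> T W; exists (node_const W T); split; first exact: node_const_gt0.
  move=> m K n nu I eps tau solve newton ops wf areaW /andP[eps0 eps1] _ sol cost.
  have eps01 : 0 < eps <= 1 by rewrite eps0 ltW.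
  apply: terminates_with_weaken (terminates_size areaW eps01 sol) => s size_s.
  split=> // eps_le; have epsk : 0 < eps <= 1 / kappa ^+ 2 by rewrite eps0.
  have cost_s N := node_cost_le N k1 epsk cost.
  split=> //; apply: le_trans (total_time_le s cost_s) _; rewrite ler_wpM2r //.
  by rewrite !mulr_ge0 ?exprn_ge0 ?sqrtr_ge0 ?ln_ge0 ?ler_pdivlMr ?mul1r //; lra.
- move=> kappa rho W T0 k1 rho0.
  exists (node_const W T0 * (2 * kappa ^+ 3 * (kappa * (1 + rho)) ^+ 3)), (1 / kappa ^+ 2).
  split.
  + by rewrite mulr_gt0 ?node_const_gt0 ?mulr_gt0 ?exprn_gt0 ?mulr_gt0 //; lra.
  + exact: threshold_lt1.
  move=> T m K n nu I eps tau solve newton ops TT0 K_le wf areaW epsk _ sol cost.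
  apply: terminates_with_weaken (total_time_bound k1 areaW epsk sol cost) => s.
  move=> /le_trans; apply.
  have [_ /andP[_ n_le] _ _ _] := cost.
  have {}n_le : n%:R <= kappa * (1 + rho) * m%:R.
    apply: le_trans n_le _; rewrite -mulrA ler_pM2l ?natrD; lra.
  have n3_le : n%:R ^+ 3 <= (kappa * (1 + rho)) ^+ 3 * m%:R ^+ 3.
    by rewrite -exprMn; apply: lerXn2r => //; rewrite nnegrE ?(le_trans _ n_le).
  have /andP[eps0 eps_le] := epsk; have /andP[_ thr1] := threshold_lt1 k1.
  have inv_eps : 1 <= 1 / eps by rewrite ler_pdivlMr // mul1r; lra.
  have ln0 : 0 <= ln (1 / eps) by rewrite ln_ge0.
  have const_le := node_const_mono (lexx `|W|) TT0.
  rewrite powR_seven_halves //.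
  have -> : node_const W T0 * (2 * kappa ^+ 3 * (kappa * (1 + rho)) ^+ 3) *
      ((1 / eps) ^+ T * (m%:R ^+ 3 * Num.sqrt m%:R) * ln (1 / eps)) =
    node_const W T0 * (1 / eps) ^+ T * (2 * kappa ^+ 3 *
      ((kappa * (1 + rho)) ^+ 3 * m%:R ^+ 3 * Num.sqrt m%:R * ln (1 / eps))) by ring.
  have k0 : 0 < kappa := lt_trans ltr01 k1.
  have pow0 : 0 <= (1 / eps) ^+ T by rewrite exprn_ge0 //; lra.
  apply: ler_pM.
  + by rewrite mulr_ge0 // ltW // node_const_gt0.
  + by rewrite !mulr_ge0 ?exprn_ge0 ?sqrtr_ge0 //; lra.
  + by rewrite ler_wpM2r.
  + by rewrite ler_pM2l ?mulr_gt0 ?exprn_gt0 // ler_wpM2r // ler_wpM2r // sqrtr_ge0.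
(* With S = m + K + 1 / eps, each of the T factors of the node count is O(S ^ 2)
     from the root area times S from 1 / eps, and the solver cost adds S ^ 3 for
     n ^ 3 and one S each for the square root and the logarithm. *)
- move=> T0; exists (3 * T0 + 5)%N => kappa B k1.
  set A := 1 + 2 * `|area_const B|.
  have A1 : 1 <= A by rewrite /A; have := normr_ge0 (area_const B); lra.
  exists (4 * kappa ^+ 6 * A ^+ T0), (1 / kappa ^+ 2); split.
  + by rewrite !mulr_gt0 ?exprn_gt0 //; lra.
  + exact: threshold_lt1.
  move=> T m K n nu I eps tau solve newton ops TT0 wf bd epsk _ sol cost.
  have areaW := root_area_quadratic wf bd.
  apply: terminates_with_weaken (total_time_bound k1 areaW epsk sol cost) => s.
  move=> /le_trans; apply.
  have [_ /andP[_ n_le] _ _ _] := cost.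
  have /andP[eps0 eps_le] := epsk; have /andP[_ thr1] := threshold_lt1 k1.
  have inv_eps : 1 <= 1 / eps by rewrite ler_pdivlMr // mul1r; lra.
  have ln0 : 0 <= ln (1 / eps) by rewrite ln_ge0.
  set S := (m + K)%:R + 1 / eps.
  have mK0 : 0 <= (m + K)%:R :> R by [].
  have S1 : 1 <= S by rewrite /S; lra.
  have eps_S : 1 / eps <= S by rewrite /S; lra.
  have m_S : m%:R <= S by rewrite /S natrD; have : 0 <= K%:R :> R by []; lra.
  have n_S : n%:R <= kappa * S.
    by apply: le_trans n_le _; rewrite ler_pM2l /S; lra.
  have sqrt_S : Num.sqrt m%:R <= S.
    rewrite -[S]ger0_norm -?sqrtr_sqr; last by lra.
    rewrite ler_sqrt ?exprn_ge0 //; last by lra.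
    by apply: le_trans m_S _; rewrite expr2; nra.
  have ln_S : ln (1 / eps) <= S.
    have -> : 1 / eps = 1 + (1 / eps - 1) by ring.
    by apply: le_trans (le_ln1Dx _) _; lra.
  have const_S : node_const (area_const B * m%:R ^+ 2) T <= 2 * (A * S ^+ 2) ^+ T.
    rewrite /node_const ler_pM2l //.
    have m2_S : m%:R ^+ 2 <= S ^+ 2 by apply: lerXn2r; rewrite ?nnegrE //; lra.
    have m20 : 0 <= m%:R ^+ 2 :> R by rewrite exprn_ge0.
    have S21 : 1 <= S ^+ 2 by rewrite exprn_ege1.
    have a0 := normr_ge0 (area_const B).
    rewrite normrM [`|_ ^+ 2|]ger0_norm //.
    by apply: lerXn2r; rewrite ?nnegrE /A; nra.
  have inv_S : (1 / eps) ^+ T <= S ^+ T by apply: lerXn2r; rewrite ?nnegrE; lra.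
  have n3_S : n%:R ^+ 3 <= (kappa * S) ^+ 3.
    by apply: lerXn2r; rewrite ?nnegrE // (le_trans _ n_S).
  have kappa0 : 0 <= kappa by lra.
  have S0 : 0 <= S by lra.
  have inv0 : 0 <= 1 / eps by lra.
  apply: (@le_trans _ _ (2 * (A * S ^+ 2) ^+ T * S ^+ T *
      (2 * kappa ^+ 3 * ((kappa * S) ^+ 3 * S * S)))).
    apply: ler_pM.
    + by rewrite mulr_ge0 ?exprn_ge0 // ltW // node_const_gt0.
    + by rewrite !mulr_ge0 ?exprn_ge0 ?sqrtr_ge0.
    + by apply: ler_pM => //; rewrite ?exprn_ge0 // ltW // node_const_gt0.
    + rewrite ler_wpM2l ?mulr_ge0 ?exprn_ge0 //.
      apply: ler_pM => //.
      by apply: ler_pM; rewrite ?exprn_ge0 ?sqrtr_ge0.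
  have -> : 2 * (A * S ^+ 2) ^+ T * S ^+ T *
      (2 * kappa ^+ 3 * ((kappa * S) ^+ 3 * S * S)) =
    4 * kappa ^+ 6 * (A ^+ T * S ^+ (3 * T + 5)).
    rewrite exprMn -exprM exprD (mulnDl 1 2 T : 3 * T = _)%N exprD mul1n.
    by ring.
  rewrite -[leRHS]mulrA ler_wpM2l ?mulr_ge0 ?exprn_ge0 //.
  apply: ler_pM; rewrite ?exprn_ge0 //; first by lra.
    exact: ler_weXn2l.
  by apply: ler_weXn2l => //; rewrite leq_add2r leq_mul2l TT0 orbT.
Qed.
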